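(* Let $\mathcal{A}=\langle Q,q_0,\delta,\omega\rangle$ be a non-alternating EU parity tree automaton (nAAPTA) over $\Sigma=\Sigma_1\times\Sigma_2$. For each $i\in\{1,2\}$ one can build an nAAPTA $\mathcal{A}_i$ over $\Sigma$ such that for every $\Sigma$-labelled tree $\mathcal{T}$: $\mathcal{T}\in\mathcal{L}(\mathcal{A}_i)$ if and only if there is a $\Sigma$-labelled tree $\mathcal{T}'\in\mathcal{L}(\mathcal{A})$ with $\mathcal{T}\equiv_{\Sigma_i}\mathcal{T}'$. The size of $\mathcal{A}_i$ is at most $\langle |Q|,\ |\Sigma_{3-i}|\cdot|\delta|_B,\ |\delta|_E,\ |\delta|_U,\ |\omega|\rangle$.
   Context: Multisets: a multiset over a set $S$ is a map $\mu:S\to\mathbb{N}$; $\mu\sqsubseteq\mu'$ iff $\mu(s)\le\mu'(s)$ for all $s$; $(\mu\ominus\mu')(s)=\max(0,\mu(s)-\mu'(s))$; $\mathrm{supp}(\mu)=\{s:\mu(s)>0\}$; $|\mu|=\sum_s\mu(s)$. An EU-pair over $S$ is $\langle E;U\rangle$ with $E$ a finite multiset over $S$ and $U\subseteq S$; a multiset $\mu$ satisfies it if $E\sqsubseteq\mu$ and $\mathrm{supp}(\mu\ominus E)\subseteq U$. An EU-constraint over $S$ is a positive boolean formula built from $\top,\bot$, EU-pairs over $S$, $\wedge,\vee$. Markings: a marking of $S'$ by $S$ is a map $\nu:S'\to 2^S$; a unitary submarking is a map $\nu':S'\to S$ with $\nu'(s')\in\nu(s')$ for all $s'$; its image multiset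 is $s\mapsto|\{s':\nu'(s')=s\}|$. $\nu$ satisfies $\langle E;U\rangle$ if some unitary submarking has image multiset satisfying it; extended to EU-constraints ($\top$ always, $\bot$ never, $\wedge,\vee$ as usual, with possibly different submarkings for different conjuncts). Trees: a $D$-tree ($D$ finite) is a prefix-closed $t\subseteq D^*$ with root $\varepsilon$; successors of $n$ are the $n\cdot d\in t$; branches are maximal root-paths (finite or infinite). A $\Sigma$-labelled tree is $(t,l)$ with $t$ a $D$-tree for some finite $D$ and $l:t\to\Sigma$. Automata: an AAPTA over $\Sigma$ is $\langle Q,q_0,\delta,\omega\rangle$, $Q$ finite, $q_0\in Q$, $\delta:Q\times\Sigma\to$ EU-constraints over $Q$, $\omega:Q\to\mathbb{N}$. It is non-alternating (an nAAPTA) if each $\delta(q,\sigma)$ is a disjunction of EU-pairs (or $\top$/$\bot$). An execution tree over $(t,l)$ is a $(D\times Q)$-tree whose node $(d_1,q_1)\cdots(d_k,q_k)$ is labelled $(d_1\cdots d_k,q_k)$ (a node of $t$), root labelled $(\varepsilon,q_0)$, such that for each node $x$ labelled $(m,q)$ the marking $\nu_x(m\cdot d)=\{q':x\cdot(d,q')\text{ is a node}\}$ of the successors of $m$ satisfies $\delta(q,l(m))$. It is accepting if on every infinite branch the least priority seen infinitely often is even. $\mathcal{L}(\mathcal{A})$ is the set of trees with an accepting execution tree. Size: $\langle |Q|,|\delta|_B,|\delta|_E,|\delta|_U,|\omega|\rangle$ with $|\delta|_B$ the maximum size of the formulas $\delta(q,\sigma)$, $|\delta|_E$ and $|\delta|_U$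 the maximum of $|E|$ and of $|U|$ over EU-pairs in $\delta$, $|\omega|$ the number of distinct priorities. Equivalence: two $\Sigma_1\times\Sigma_2$-labelled trees $(t,l)$ and $(t',l')$ satisfy $(t,l)\equiv_{\Sigma_1}(t',l')$ if $t=t'$ and the first components of $l(n)$ and $l'(n)$ coincide for every node $n$; $\equiv_{\Sigma_2}$ is defined analogously with second components. *)

(* Defs.v *)
From HB Require Import structures.
From mathcomp Require Import all_boot.
From mathcomp Require Import boolp classical_sets.

Set Implicit Arguments.
Unset Strict Implicit.
Unset Printing Implicit Defensive.

Section Multisets.
Variable S : finType.

Definition mset := {ffun S -> nat}.
Definition msubset (mu mu' : mset) : bool := [forall s, mu s <= mu' s].
(* Subtraction on nat is truncated, i.e. max(0, mu s - mu' s). *)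
Definition mdiff (mu mu' : mset) : mset := [ffun s => mu s - mu' s].
Definition msupp (mu : mset) : {set S} := finset (fun s => 0 < mu s).
Definition mcard (mu : mset) : nat := \sum_(s : S) mu s.

End Multisets.

Section EU.
Variable S : finType.

Record eu_pair := EUPair { eu_E : mset S; eu_U : {set S} }.

Definition msat (p : eu_pair) (mu : mset S) : bool :=
  msubset (eu_E p) mu && (msupp (mdiff mu (eu_E p)) \subset eu_U p).

Inductive eu_constraint :=
| EUtop
| EUbot
| EUatom of eu_pair
| EUand of eu_constraint & eu_constraint
| EUor of eu_constraint & eu_constraint.

Section Markings.
Variable S' : finType.

Definition marking := S' -> {set S}.

Definition unitary_submarking (nu : marking) (nu' : S' -> S) : Prop :=
  forall s', nu' s' \in nu s'.

Definition image_mset (nu' : S' -> S) : mset S :=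
  [ffun s => #|finset (fun s' => nu' s' == s)|].

Fixpoint eu_sat (phi : eu_constraint) (nu : marking) : Prop :=
  match phi with
  | EUtop => True
  | EUbot => False
  | EUatom p =>
      exists2 nu', unitary_submarking nu nu' & msat p (image_mset nu')
  | EUand a b => eu_sat a nu /\ eu_sat b nu
  | EUor a b => eu_sat a nu \/ eu_sat b nu
  end.

End Markings.

Fixpoint eu_pairs (phi : eu_constraint) : seq eu_pair :=
  match phi with
  | EUtop | EUbot => [::]
  | EUatom p => [:: p]
  | EUand a b | EUor a b => eu_pairs a ++ eu_pairs b
  end.

(* The size of a formula is its number of occurrences of atoms (top, bottom
   and EU-pairs); the binary connectives, always one fewer than the atoms, are
   not counted, so that a disjunction of k formulas of size at most b has size
   at most k * b. *)
Fixpoint eu_size (phi : eu_constraint) : nat :=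
  match phi with
  | EUtop | EUbot | EUatom _ => 1
  | EUand a b | EUor a b => eu_size a + eu_size b
  end.

Fixpoint is_pair_disjunction (phi : eu_constraint) : bool :=
  match phi with
  | EUatom _ => true
  | EUor a b => is_pair_disjunction a && is_pair_disjunction b
  | _ => false
  end.

(* Top and bottom are allowed only as the whole formula. *)
Definition nonalternating_constraint (phi : eu_constraint) : bool :=
  match phi with
  | EUtop | EUbot => true
  | _ => is_pair_disjunction phi
  end.

End EU.

Arguments EUtop {S}.
Arguments EUbot {S}.

Record tree (D : finType) := Tree {
  nodes : set (seq D);
  tree_root : nodes [::];
  tree_prefix : forall m n, prefix m n -> nodes n -> nodes m
}.

(* The direction [d] is identified with the successor [rcons n d] of [n]. *)
Definition successors (D : finType) (t : tree D) (n : seq D) : {set D} :=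
  finset (fun d => `[< nodes t (rcons n d) >]).

(* The infinite word [b] is an infinite branch; such a path is maximal. *)
Definition infinite_branch (D : finType) (t : tree D) (b : nat -> D) : Prop :=
  forall k, nodes t (mkseq b k).

(* Only the values of [label] on the nodes of the tree are meaningful. *)
Record ltree (D Sigma : finType) := LTree {
  ltree_tree :> tree D;
  label : seq D -> Sigma
}.

Record aapta (Sigma : finType) := Aapta {
  state : finType;
  init : state;
  delta : state -> Sigma -> eu_constraint state;
  priority : state -> nat
}.

Definition nonalternating (Sigma : finType) (A : aapta Sigma) : Prop :=
  forall q s, nonalternating_constraint (@delta _ A q s).

Section Executions.
Variables (Sigma : finType) (A : aapta Sigma) (D : finType).
Implicit Types (T : ltree D Sigma) (X : tree (D * state A)%type).
Implicit Types (x : seq (D * state A)).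

(* [(exec_pos x, exec_state x)] is the label of the node [x]. *)
Definition exec_pos x : seq D := [seq p.1 | p <- x].
Definition exec_state x : state A := last (init A) [seq p.2 | p <- x].

Definition exec_marking T X x :
    marking (state A) {d : D | d \in successors T (exec_pos x)} :=
  fun d => finset (fun q' => `[< nodes X (rcons x (val d, q')) >]).

Definition execution_tree T X : Prop :=
  forall x, nodes X x ->
    nodes T (exec_pos x) /\
    eu_sat (delta (exec_state x) (label T (exec_pos x)))
           (@exec_marking T X x).

Definition infinitely_often (u : nat -> nat) (p : nat) : Prop :=
  forall n, exists2 k, n <= k & u k = p.

Definition accepting X : Prop :=
  forall b, infinite_branch X b ->
    let u k := priority (exec_state (mkseq b k)) in
    exists p, [/\ infinitely_often u p,
                  forall p', infinitely_often u p' -> p <= p'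
                & ~~ odd p].

Definition language T : Prop :=
  exists X, execution_tree T X /\ accepting X.

End Executions.

Record asize := ASize {
  size_Q : nat;
  size_B : nat;
  size_E : nat;
  size_U : nat;
  size_omega : nat
}.

Definition asize_le (s s' : asize) : Prop :=
  [/\ size_Q s <= size_Q s', size_B s <= size_B s', size_E s <= size_E s',
      size_U s <= size_U s' & size_omega s <= size_omega s'].

Section Size.
Variables (Sigma : finType) (A : aapta Sigma).

Definition delta_B : nat :=
  \max_(q : state A) \max_(s : Sigma) eu_size (delta q s).
Definition delta_E : nat :=
  \max_(q : state A) \max_(s : Sigma)
    \max_(p <- eu_pairs (delta q s)) mcard (eu_E p).
Definition delta_U : nat :=
  \max_(q : state A) \max_(s : Sigma)
    \max_(p <- eu_pairs (delta q s)) #|eu_U p|.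
Definition num_priorities : nat := size (undup (codom (@priority _ A))).

Definition aapta_size : asize :=
  ASize #|state A| delta_B delta_E delta_U num_priorities.

End Size.

Section Equivalence.
Variables (Sigma1 Sigma2 D : finType).
Implicit Types T : ltree D (Sigma1 * Sigma2)%type.

Definition equiv1 T T' : Prop :=
  nodes T = nodes T' /\
  forall n, nodes T n -> (label T n).1 = (label T' n).1.

Definition equiv2 T T' : Prop :=
  nodes T = nodes T' /\
  forall n, nodes T n -> (label T n).2 = (label T' n).2.

End Equivalence.

(* Main.v *)
Require Import Defs.
From mathcomp Require Import all_boot.
From mathcomp Require Import boolp.

Set Implicit Arguments.
Unset Strict Implicit.
Unset Printing Implicit Defensive.

(** The projected automaton reads [s] by guessing a letter [s'] with the same
    projection: its transition formula is the disjunction of the formulas of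
    [A] over all such [s'].  Its runs may a priori guess different letters in
    different copies sent to the same node of the input tree.  As the formulas
    are disjunctions of EU-pairs, every run can be pruned, keeping at each of
    its nodes a single unitary submarking, so that each node of the input tree
    is visited by at most one copy; the guesses of the pruned run then form a
    relabelling of the input tree that [A] accepts. *)

(** * Finite disjunctions of EU-constraints and their sizes *)

Section Join.
Variable S : finType.
Implicit Types phi psi : eu_constraint S.

(* Disjunction that keeps top and bottom out of proper subformulas. *)
Definition eu_join phi psi : eu_constraint S :=
  match phi, psi with
  | EUtop, _ | _, EUtop => EUtop
  | EUbot, _ => psi
  | _, EUbot => phi
  | _, _ => EUor phi psi
  end.

Lemma eu_joinb phi : eu_join phi EUbot = phi.
Proof. by case: phi. Qed.

Lemma eu_join_sat (S' : finType) phi psi (nu : marking S S') :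
  eu_sat (eu_join phi psi) nu <-> eu_sat phi nu \/ eu_sat psi nu.
Proof. by case: phi => [||?|? ?|? ?]; case: psi => [||?|? ?|? ?] /=; tauto. Qed.

Lemma eu_join_nonalternating phi psi :
  nonalternating_constraint phi -> nonalternating_constraint psi ->
  nonalternating_constraint (eu_join phi psi).
Proof.
by case: phi => [||?|//|? ?]; case: psi => [||?|//|? ?] //= -> // ->.
Qed.

Lemma eu_size_gt0 phi : 0 < eu_size phi.
Proof. by elim: phi => //= phi IH psi _; rewrite addn_gt0 IH. Qed.

Lemma eu_join_size phi psi :
  eu_size (eu_join phi psi) <= eu_size phi + eu_size psi.
Proof.
by case: phi => [||?|? ?|? ?]; case: psi => [||?|? ?|? ?] //=;
  rewrite ?leq_addl ?leq_addr // ?addn_gt0 ?eu_size_gt0.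
Qed.

Lemma eu_join_pairs (f : eu_pair S -> nat) phi psi :
  \max_(p <- eu_pairs (eu_join phi psi)) f p <=
  maxn (\max_(p <- eu_pairs phi) f p) (\max_(p <- eu_pairs psi) f p).
Proof.
by rewrite -big_cat; case: phi => [||?|? ?|? ?]; case: psi => [||?|? ?|? ?];
  rewrite /= ?cats0 ?big_nil.
Qed.

Variables (I : eqType) (F : I -> eu_constraint S).
Implicit Types r : seq I.

Definition eu_bigor r := foldr eu_join EUbot (map F r).

Lemma eu_bigor_sat (S' : finType) r (nu : marking S S') :
  eu_sat (eu_bigor r) nu <-> exists2 i, i \in r & eu_sat (F i) nu.
Proof.
elim: r => [|i r IH]; first by split=> // -[].
rewrite /eu_bigor /= eu_join_sat IH; split=> [[Fi|[j jr Fj]]|[j]].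
- by exists i; rewrite ?mem_head.
- by exists j; rewrite // inE jr orbT.
- by rewrite inE => /predU1P[-> | jr] Fj; [left | right; exists j].
Qed.

Lemma eu_bigor_nonalternating r :
  (forall i, nonalternating_constraint (F i)) ->
  nonalternating_constraint (eu_bigor r).
Proof. by move=> nF; elim: r => //= i r; apply: eu_join_nonalternating. Qed.

(** The final [EUbot] of the fold is absorbed by [eu_join], so only the members of [r] count. An
    empty [r] would leave [EUbot], of size 1. *)
Lemma eu_bigor_size r b :
  0 < size r -> (forall i, eu_size (F i) <= b) ->
  eu_size (eu_bigor r) <= size r * b.
Proof.
case: r => // i r _ leFb; rewrite /eu_bigor.
elim: r i => [|j r IH] i; first by rewrite /= eu_joinb mul1n.
apply: (leq_trans (eu_join_size _ _)); rewrite mulSn.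
exact: leq_add (leFb i) (IH j).
Qed.

Lemma eu_bigor_pairs (f : eu_pair S -> nat) r b :
  (forall i, \max_(p <- eu_pairs (F i)) f p <= b) ->
  \max_(p <- eu_pairs (eu_bigor r)) f p <= b.
Proof.
move=> leFb; elim: r => [|i r IH]; first by rewrite big_nil.
by apply: (leq_trans (eu_join_pairs _ _ _)); rewrite geq_max leFb.
Qed.

End Join.

(** * Pruning a marking to at most one state per successor *)

Section Pruning.
Variables (S S' : finType).

Definition partial_marking (c : S' -> option S) : marking S S' :=
  fun s' => finset (fun s => c s' == Some s).

(* A partial map is needed because top is satisfied without any successor. *)
Lemma nonalternating_prune (phi : eu_constraint S) (nu : marking S S') :
  nonalternating_constraint phi -> eu_sat phi nu ->
  exists2 c : S' -> option S,
    forall s' s, c s' = Some s -> s \in nu s' & eu_sat phi (partial_marking c).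
Proof.
have [-> _ _|] := pselect (phi = EUtop); first by exists (fun=> None).
move=> ntop nphi; have {ntop nphi}: phi = EUbot \/ is_pair_disjunction phi.
  by case: phi ntop nphi => [||?|? ?|? ?]; [|left|right..].
case=> [-> //|]; elim: phi => //= [p _ [f fnu fp]|phi IHphi psi IHpsi].
  (* The marking by the singletons of [f] still has [f] as a unitary submarking, with the same image
     multiset. *)
  exists (Some \o f) => [s' s [<-]|]; first exact: fnu.
  by exists f => // s'; rewrite inE.
by case/andP=> nphi npsi [/(IHphi nphi)|/(IHpsi npsi)] [c cnu csat];
  exists c => //; [left | right].
Qed.

End Pruning.

(** * The projected automaton: transitions and size *)

Section Projection.
Variables (Sigma I : finType) (pi : Sigma -> I) (A : aapta Sigma).

Definition fibre (s : Sigma) : seq Sigma :=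
  [seq s' <- enum Sigma | pi s' == pi s].

Definition projection : aapta Sigma :=
  Aapta (init A) (fun q s => eu_bigor (delta q) (fibre s)) (@priority _ A).

Lemma projection_sat (S' : finType) (q : state A) s
    (nu : marking (state A) S') :
  eu_sat (@delta _ projection q s) nu <->
  exists2 s', pi s' = pi s & eu_sat (delta q s') nu.
Proof.
rewrite eu_bigor_sat /fibre.
split=> -[s' s's sat]; exists s' => //.
  by move: s's; rewrite mem_filter => /andP[/eqP].
by rewrite mem_filter s's eqxx mem_enum.
Qed.

Lemma projection_size k :
  (forall s, size (fibre s) <= k) ->
  asize_le (aapta_size projection)
    (ASize #|state A| (k * delta_B A) (delta_E A) (delta_U A)
           (num_priorities A)).
Proof.
move=> lek.
have le_pairs f q s :
    \max_(p <- eu_pairs (@delta _ projection q s)) f p <=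
    \max_q \max_s \max_(p <- eu_pairs (@delta _ A q s)) f p.
  apply: eu_bigor_pairs => s'; rewrite (bigD1 q) //= leq_max.
  by rewrite (bigD1 s') //= leq_maxl.
split=> //; apply/bigmax_leqP => q _; apply/bigmax_leqP => s _;
  [|exact: le_pairs..].
apply: (@leq_trans (size (fibre s) * delta_B A)); last first.
  by rewrite leq_mul2r lek orbT.
apply: eu_bigor_size => [|s'].
  (* The disjunction is nonempty because [s] lies in its own fibre. *)
  by rewrite size_filter -has_count; apply/hasP; exists s; rewrite ?mem_enum.
by rewrite /delta_B (bigD1 q) //= leq_max (bigD1 s') //= leq_maxl.
Qed.

Lemma projection_nonalternating : nonalternating A -> nonalternating projection.
Proof. by move=> nA q s; apply: eu_bigor_nonalternating. Qed.

(** * Transfer of runs between an automaton and its projection *)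

Section Runs.
Variable D : finType.
Implicit Types (T : ltree D Sigma) (X : tree (D * state A)%type).
Implicit Types (x y : seq (D * state A)).

Definition equiv_by T T' :=
  nodes T = nodes T' /\
  forall n, nodes T n -> pi (label T n) = pi (label T' n).

(** Markings are typed by the successors in the input tree, so an execution tree can be reused as it
    stands only once the trees themselves are identified. *)
Lemma tree_inj (t t' : tree D) : nodes t = nodes t' -> t = t'.
Proof.
case: t t' => [N r p] [N' r' p'] /= eqN; case: N' / eqN in r' p' *.
by congr Tree; apply: Prop_irrelevance.
Qed.

Lemma language_projection_of_equiv T T' :
  language A T' -> equiv_by T T' -> language projection T.
Proof.
case: T T' => [t l] [t' l'] [X [exX accX]] [/= /tree_inj eqt eql].
case: t' / eqt in exX *; exists X; split=> // x Xx.
have [tx satx] := exX x Xx; split=> //.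
by apply/projection_sat; exists (l' (exec_pos x)); rewrite ?eql.
Qed.

Section Prune.
Variables (X : tree (D * state A)%type).
Variable c : seq (D * state A) -> D -> option (state A).

(** Constraining every step on the path to [x], not just the last, makes prefix closure
    immediate. *)
Definition pruned_nodes x :=
  nodes X x /\ forall y d q, prefix (rcons y (d, q)) x -> c y d = Some q.

Lemma pruned_root : pruned_nodes [::].
Proof. by split=> [|y d q]; [apply: tree_root | rewrite prefixs0; case: y]. Qed.

Lemma pruned_prefix x y : prefix x y -> pruned_nodes y -> pruned_nodes x.
Proof.
move=> xy [Xy cy]; split=> [|z d q zx]; first exact: tree_prefix xy Xy.
exact: cy (prefix_trans zx xy).
Qed.

Definition pruned_tree : tree (D * state A)%type :=
  Tree pruned_root pruned_prefix.

Lemma pruned_rcons x d q :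
  pruned_nodes (rcons x (d, q)) <->
  [/\ pruned_nodes x, nodes X (rcons x (d, q)) & c x d = Some q].
Proof.
split=> [xdq|[[_ cx] Xxdq cxd]].
  split; [exact: pruned_prefix (prefix_rcons _ _) xdq | exact: xdq.1 |].
  by apply: xdq.2; apply: prefix_refl.
split=> // y d' q' /prefixP[z]; case: (lastP z) => [|{}z e].
  by rewrite cats0 => /rcons_inj[<- <- <-].
by rewrite -rcons_cat => /rcons_inj[xE _]; apply: cx; rewrite xE prefix_prefix.
Qed.

Lemma exec_pos_rcons x d q : exec_pos (rcons x (d, q)) = rcons (exec_pos x) d.
Proof. exact: map_rcons. Qed.

(** By induction from the end: equal positions have equal parents, and [c] then fixes the state
    reached in the common last direction. *)
Lemma pruned_pos_inj x y :
  pruned_nodes x -> pruned_nodes y -> exec_pos x = exec_pos y -> x = y.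
Proof.
elim/last_ind: x y => [|x [d q] IH] y; case: (lastP y) => [//|{}y [d' q']];
  rewrite ?exec_pos_rcons.
- by move=> _ _ /(congr1 size); rewrite size_rcons.
- by move=> _ _ /(congr1 size); rewrite size_rcons.
move=> /pruned_rcons[px _ cx] /pruned_rcons[py _ cy] /rcons_inj[xy dd'].
by rewrite -dd' -(IH _ px py xy) cx in cy *; case: cy => ->.
Qed.

End Prune.

(** The existential precedes the hypothesis [nodes X x] so that the axiom of choice yields total
    functions on sequences. *)
Lemma projection_prune T X : nonalternating A ->
  @execution_tree _ projection _ T X ->
  forall x, exists cs : (D -> option (state A)) * Sigma, nodes X x ->
    [/\ pi cs.2 = pi (label T (exec_pos x)),
        forall d q, cs.1 d = Some q -> nodes X (rcons x (d, q))
      & eu_sat (delta (exec_state x) cs.2)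
          (partial_marking
             (fun d : {d | d \in successors T (exec_pos x)} => cs.1 (val d)))].
Proof.
move=> nA exX x; have [Xx|nXx] := pselect (nodes X x); last first.
  by exists (fun=> None, label T [::]) => /nXx.
have [_ /projection_sat[s sE sat]] := exX x Xx.
have [c cX csat] := nonalternating_prune (nA _ _) sat.
(* The choice on successors is extended to all of [D] by [None]. *)
exists (fun d => obind c (insub d), s) => _; split=> //= [d q|].
  case: insubP => //= d' _ <- /cX.
  by rewrite inE => /asboolP.
congr eu_sat: csat; apply: funext => d; apply/setP => q.
by rewrite !inE valK.
Qed.

Lemma equiv_of_language_projection T :
  nonalternating A -> language projection T ->
  exists2 T', language A T' & equiv_by T T'.
Proof.
move=> nA [X [exX accX]].
have [cs csP] := choice (projection_prune nA exX).
pose c x := (cs x).1; pose Y := pruned_tree X c.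
(* A visited position takes the letter guessed by its only copy; an unvisited one keeps its own
   letter. *)
have /choice[l lP] m : exists s, pi s = pi (label T m) /\
    forall x, nodes Y x -> exec_pos x = m -> s = (cs x).2.
  have [[x [Yx xm]]|nm] := pselect (exists x, nodes Y x /\ exec_pos x = m).
    exists (cs x).2; have [-> _ _] := csP x Yx.1; rewrite xm.
    split=> // y Yy ym.
    by rewrite (pruned_pos_inj Yx Yy) // xm ym.
  by exists (label T m); split=> // x Yx xm; case: nm; exists x.
exists (LTree T l); last by split=> // n _; rewrite (lP n).1.
(* An infinite branch of [Y] is one of [X], with the same priorities. *)
exists Y; split=> [x Yx|b Yb]; last exact: accX (fun k => (Yb k).1).
split; first exact: (exX x Yx.1).1.
have [_ cX] := csP x Yx.1; rewrite /= ((lP _).2 x Yx erefl).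
(* The successors kept in [Y] are exactly those selected by [c]. *)
congr eu_sat; apply: funext => d; apply/setP => q; rewrite !inE.
apply/eqP/asboolP => [cd|/pruned_rcons[]]//.
by apply/pruned_rcons; split=> //; apply: cX.
Qed.

Lemma language_projection T : nonalternating A ->
  language projection T <-> exists2 T', language A T' & equiv_by T T'.
Proof.
move=> nA; split; first exact: equiv_of_language_projection.
by case=> T' LT'; apply: language_projection_of_equiv.
Qed.

End Runs.
End Projection.

(** * Fibres of the two projections, and the conclusion *)

Lemma size_fibre_fst (Sigma1 Sigma2 : finType) (s : Sigma1 * Sigma2) :
  size (fibre fst s) <= #|Sigma2|.
Proof.
rewrite cardE -(size_map (pair s.1) (enum Sigma2)).
apply: uniq_leq_size => [|[a b]].
  exact/filter_uniq/enum_uniq.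
by rewrite mem_filter => /andP[/eqP/= -> _]; rewrite map_f ?mem_enum.
Qed.

Lemma size_fibre_snd (Sigma1 Sigma2 : finType) (s : Sigma1 * Sigma2) :
  size (fibre snd s) <= #|Sigma1|.
Proof.
rewrite cardE -(size_map (pair^~ s.2) (enum Sigma1)).
apply: uniq_leq_size => [|[a b]].
  exact/filter_uniq/enum_uniq.
rewrite mem_filter => /andP[/eqP/= -> _].
by apply/mapP; exists a; rewrite ?mem_enum.
Qed.

Theorem theorem2 (Sigma1 Sigma2 : finType)
    (A : aapta (Sigma1 * Sigma2)%type) (nA : nonalternating A) :
  (exists A1 : aapta (Sigma1 * Sigma2)%type,
    [/\ nonalternating A1,
        forall (D : finType) (T : ltree D (Sigma1 * Sigma2)%type),
          language A1 T <-> exists2 T', language A T' & equiv1 T T'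
      & asize_le (aapta_size A1)
          (ASize #|state A| (#|Sigma2| * delta_B A) (delta_E A) (delta_U A)
                 (num_priorities A))])
  /\
  (exists A2 : aapta (Sigma1 * Sigma2)%type,
    [/\ nonalternating A2,
        forall (D : finType) (T : ltree D (Sigma1 * Sigma2)%type),
          language A2 T <-> exists2 T', language A T' & equiv2 T T'
      & asize_le (aapta_size A2)
          (ASize #|state A| (#|Sigma1| * delta_B A) (delta_E A) (delta_U A)
                 (num_priorities A))]).
Proof.
split; [exists (projection fst A) | exists (projection snd A)].
  split; first exact: projection_nonalternating.
    by move=> D T; apply: language_projection.
  exact/projection_size/size_fibre_fst.
split; first exact: projection_nonalternating.
  by move=> D T; apply: language_projection.
exact/projection_size/size_fibre_snd.
Qed.
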